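(* Let $A\in\mathrm{SL}(2,\mathbb Z)$ be hyperbolic and let $F_\Phi$ be a quaternionic lift of $A$. Then $F_\Phi$ is not an Anosov diffeomorphism of $\mathrm{SU}(2)^2$. It is also not $C^1$-structurally stable.
   Context: $A\in\mathrm{SL}(2,\mathbb Z)$ is hyperbolic if $|\operatorname{tr}A|>2$. $F_2=\langle x,y\rangle$ is the free group. For $\Phi\in\operatorname{Aut}(F_2)$, $F_\Phi:\mathrm{SU}(2)^2\to\mathrm{SU}(2)^2$ is the real-analytic diffeomorphism $F_\Phi(q_1,q_2)=(\Phi(x)(q_1,q_2),\Phi(y)(q_1,q_2))$, where $w(q_1,q_2)$ denotes substitution of $q_1$ for $x$ and $q_2$ for $y$ in a word $w$. The row exponent matrix $\mathrm R(\Phi)$ has first row the exponent sums (in $x$ and in $y$) of $\Phi(x)$ and second row those of $\Phi(y)$; a quaternionic lift of $A$ is a map $F_\Phi$ with $\mathrm R(\Phi)=A$. A diffeomorphism $f$ of a compact manifold is $C^1$-structurally stable if every diffeomorphism sufficiently $C^1$-close to $f$ is topologically conjugate to $f$. Mañé's theorem (a $C^1$-structurally stable diffeomorphism satisfies Axiom A and the strong transversality condition; in particular all its periodic points are hyperbolic) may be assumed. *)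

(* Defs.v *)
From HB Require Import structures.
From mathcomp Require Import all_boot all_order all_algebra.
From mathcomp Require Import spectral.
From mathcomp Require Import all_classical all_reals all_analysis.
From mathcomp Require Import complex.

Set Implicit Arguments.
Unset Strict Implicit.
Unset Printing Implicit Defensive.

Import Order.TTheory GRing.Theory Num.Theory.
Import numFieldNormedType.Exports.

Local Open Scope ring_scope.
Local Open Scope classical_set_scope.

(* The free group on two generators, as the group of reduced words.  The      *)
(* letter (i, false) is the i-th generator (0 for x, 1 for y) and (i, true)   *)
(* is its inverse.                                                            *)

Definition letter : Type := ('I_2 * bool)%type.

Definition linv (a : letter) : letter := (a.1, ~~ a.2).

Fixpoint reduced (w : seq letter) : bool :=
  if w is a :: w' then
    (if w' is b :: _ then b != linv a else true) && reduced w'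
  else true.

Definition push (a : letter) (w : seq letter) : seq letter :=
  if w is b :: w' then if b == linv a then w' else a :: w else [:: a].

Definition wmul (u v : seq letter) : seq letter := foldr push v u.

Definition winv (w : seq letter) : seq letter := rev (map linv w).

Lemma linvK : involutive linv.
Proof. by case=> i b; rewrite /linv /= negbK. Qed.

Lemma linv_neq a : a != linv a.
Proof. by case: a => i []; rewrite /linv /= xpair_eqE andbF. Qed.

Lemma reduced_behead a w : reduced (a :: w) -> reduced w.
Proof. by move=> /= /andP[]. Qed.

Lemma reduced_push a w : reduced w -> reduced (push a w).
Proof.
case: w => [//|b w] rw; rewrite /push.
case: ifPn => [_|ab]; first exact: reduced_behead rw.
by rewrite [reduced (a :: _)]/= ab.
Qed.

Lemma pushK a w : reduced w -> push (linv a) (push a w) = w.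
Proof.
case: w => [|b w] rw /=; first by rewrite linvK eqxx.
case: ifPn => [/eqP ba|_] /=; last by rewrite linvK eqxx.
case: w rw => [_|c w /= /andP[cb _]] /=; first by rewrite ba.
by rewrite -ba (negbTE cb).
Qed.

Lemma pushKV a w : reduced w -> push a (push (linv a) w) = w.
Proof. by move=> rw; rewrite -{1}(linvK a) pushK. Qed.

Lemma reduced_wmul u v : reduced v -> reduced (wmul u v).
Proof. by move=> rv; elim: u => //= a u; exact: reduced_push. Qed.

Lemma wmul_push a u v : reduced v -> wmul (push a u) v = push a (wmul u v).
Proof.
case: u => [//|b u] rv; rewrite {1}/push; case: ifPn => [/eqP ->|//].
by rewrite /= pushKV//; exact: reduced_wmul.
Qed.

Lemma wmulA u v w : reduced w -> wmul u (wmul v w) = wmul (wmul u v) w.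
Proof.
by move=> rw; elim: u => //= a u IHu; rewrite wmul_push// IHu.
Qed.

Lemma wmulw0 u : reduced u -> wmul u [::] = u.
Proof.
elim: u => //= a u IHu /andP[au ru]; rewrite IHu//.
by case: u au {IHu ru} => //= b u /negbTE ->.
Qed.

Lemma wmul_cat u v w : wmul (u ++ v) w = wmul u (wmul v w).
Proof. by rewrite /wmul foldr_cat. Qed.

Lemma wmulVw_aux u v : reduced v -> wmul (winv u) (wmul u v) = v.
Proof.
move=> rv; elim: u => //= a u IHu.
rewrite /winv /= rev_cons -cats1 wmul_cat /= pushK ?IHu//.
exact: reduced_wmul.
Qed.

Lemma winvK : involutive winv.
Proof.
move=> u; rewrite /winv -map_rev revK -map_comp map_id_in// => a _ /=.
exact: linvK.
Qed.

Lemma reduced_cat_rcons u a b v : reduced (rcons u a) -> b != linv a ->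
  reduced (b :: v) -> reduced (rcons u a ++ b :: v).
Proof.
elim: u => [|c u IHu] /= => [_ -> ->//|/andP[cu ru] ba rbv].
rewrite IHu// andbT.
by case: u cu {IHu ru}.
Qed.

Lemma reduced_winv u : reduced u -> reduced (winv u).
Proof.
rewrite /winv; elim: u => //= a [|b u] IHu /andP[ab ru] //.
have := IHu ru; rewrite /= !rev_cons -[rcons (rcons _ _) _]cats1 => rbu.
apply: reduced_cat_rcons => //.
by apply: contra ab => /eqP ab; rewrite -(linvK a) ab !linvK.
Qed.

Record F2 := MkF2 { F2val :> seq letter; F2P : reduced F2val }.

HB.instance Definition _ := [isSub for F2val].
HB.instance Definition _ := [Choice of F2 by <:].

Definition F2one : F2 := MkF2 (isT : reduced [::]).
Definition F2mul (u v : F2) : F2 := MkF2 (reduced_wmul u (F2P v)).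
Definition F2inv (u : F2) : F2 := MkF2 (reduced_winv (F2P u)).

Lemma F2mulA : associative F2mul.
Proof. by move=> u v w; apply/val_inj/wmulA/F2P. Qed.
Lemma F2mul1 : left_id F2one F2mul.
Proof. by move=> u; exact/val_inj. Qed.
Lemma F2mulr1 : right_id F2one F2mul.
Proof. by move=> u; apply/val_inj/wmulw0/F2P. Qed.
Lemma F2mulV : left_inverse F2one F2inv F2mul.
Proof.
move=> u; apply/val_inj => /=.
by rewrite -{2}(wmulw0 (F2P u)) wmulVw_aux.
Qed.
Lemma F2mulrV : right_inverse F2one F2inv F2mul.
Proof.
by move=> u; apply/val_inj; rewrite /= -{1}(winvK u); apply/(congr1 val (F2mulV (F2inv u))).
Qed.

HB.instance Definition _ :=
  isGroup.Build F2 F2mulA F2mul1 F2mulr1 F2mulV F2mulrV.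

Definition F2gen (i : 'I_2) : F2 := MkF2 (isT : reduced [:: (i, false)]).

(* The substitution w(q 0, q 1). *)
Definition word_eval (G : groupType) (q : 'I_2 -> G) (w : F2) : G :=
  (\prod_(a <- F2val w) (if a.2 then (q a.1)^-1 else q a.1))%g.

Definition exponent_sum (j : 'I_2) (w : F2) : int :=
  \sum_(a <- F2val w | a.1 == j) (if a.2 then -1 else 1).

Definition row_exponent (Phi : F2 -> F2) : 'M[int]_2 :=
  \matrix_(i, j) exponent_sum j (Phi (F2gen i)).

Definition hyperbolic_mx (A : 'M[int]_2) : Prop := 2 < `|\tr A|.

Section SU2.
Variable R : realType.

Record SU2 := MkSU2 {
  SU2val :> 'M[R[i]]_2;
  SU2P : (SU2val \is unitarymx) && (\det SU2val == 1) }.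

HB.instance Definition _ := [isSub for SU2val].
HB.instance Definition _ := [Choice of SU2 by <:].

Local Open Scope sesquilinear_scope.

Lemma SU2one_subproof :
  ((1%:M : 'M[R[i]]_2) \is unitarymx) && (\det (1%:M : 'M[R[i]]_2) == 1).
Proof.
by rewrite det1 eqxx andbT; apply/unitarymxP; rewrite mul1mx trmx1 map_mx1.
Qed.

Lemma SU2mul_subproof (U V : SU2) :
  ((U *m V : 'M[R[i]]_2) \is unitarymx) && (\det (U *m V : 'M[R[i]]_2) == 1).
Proof.
have /andP[uU /eqP dU] := SU2P U; have /andP[uV /eqP dV] := SU2P V.
by rewrite mul_unitarymx//= det_mulmx dU dV mulr1.
Qed.

Lemma SU2inv_subproof (U : SU2) :
  ((invmx U : 'M[R[i]]_2) \is unitarymx) && (\det (invmx U : 'M[R[i]]_2) == 1).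
Proof.
have /andP[uU /eqP dU] := SU2P U.
by rewrite det_inv dU invr1 eqxx andbT invmx_unitary// trmxC_unitary.
Qed.

Definition SU2one : SU2 := MkSU2 SU2one_subproof.
Definition SU2mul (U V : SU2) : SU2 := MkSU2 (SU2mul_subproof U V).
Definition SU2inv (U : SU2) : SU2 := MkSU2 (SU2inv_subproof U).

Lemma SU2_unit (U : SU2) : (U : 'M[R[i]]_2) \in unitmx.
Proof. by have /andP[/unitarymx_unit] := SU2P U. Qed.

Lemma SU2mulA : associative SU2mul.
Proof. by move=> U V W; apply/val_inj/mulmxA. Qed.
Lemma SU2mul1 : left_id SU2one SU2mul.
Proof. by move=> U; apply/val_inj/mul1mx. Qed.
Lemma SU2mulr1 : right_id SU2one SU2mul.
Proof. by move=> U; apply/val_inj/mulmx1. Qed.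
Lemma SU2mulV : left_inverse SU2one SU2inv SU2mul.
Proof. by move=> U; apply/val_inj/mulVmx/SU2_unit. Qed.
Lemma SU2mulrV : right_inverse SU2one SU2inv SU2mul.
Proof. by move=> U; apply/val_inj/mulmxV/SU2_unit. Qed.

HB.instance Definition _ :=
  isGroup.Build SU2 SU2mulA SU2mul1 SU2mulr1 SU2mulV SU2mulrV.

Definition F_ (Phi : F2 -> F2) (q : SU2 * SU2) : SU2 * SU2 :=
  let q' (i : 'I_2) := if i == 0 then q.1 else q.2 in
  (word_eval q' (Phi (F2gen 0)), word_eval q' (Phi (F2gen 1))).

(* The real vector space M_2(C), split into real and imaginary parts because  *)
(* the norm of matrices over R[i] is not R-valued.                            *)
Local Notation realM2C := ('M[R]_2 * 'M[R]_2)%type.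

Definition reim (U : 'M[R[i]]_2) : realM2C :=
  (map_mx (@complex.Re R) U, map_mx (@complex.Im R) U).

Definition emb (q : SU2 * SU2) : (realM2C * realM2C)%type :=
  (reim q.1, reim q.2).

End SU2.

(* C^1 dynamics on a compact submanifold of a finite-dimensional normed       *)
(* space V; the submanifold is given as a type M with an injection e into V.  *)
(* All norms on V induce equivalent Finsler metrics on M, so neither the      *)
(* Anosov property nor the C^1 topology depends on the norm of V.             *)
Section EmbeddedManifold.
Variables (R : realType) (M : choiceType) (V : normedModType R) (e : M -> V).
Implicit Types (f g : M -> M) (p : M) (F : V -> V).

(* velocities of the curves in M through p *)
Definition tangent p : set V :=
  [set v | exists gamma : R -> M,
     gamma 0 = p /\ is_derive (0 : R) (1 : R) (e \o gamma) v].

Definition C1_near F (x : V) : Prop :=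
  \forall y \near x, differentiable F y /\
    forall v, {for y, continuous (fun z => 'd F z v)}.

(* F is a C^1 extension of f to a neighbourhood of p in V *)
Definition C1_extension f p F : Prop :=
  C1_near F (e p) /\
  \forall x \near e p, forall q, e q = x -> F x = e (f q).

Definition C1 f : Prop := forall p, exists F, C1_extension f p F.

(* The tangent map of f at p; on tangent vectors it does not depend on the    *)
(* extension that is chosen, and it is only ever applied to those.            *)
Definition tangent_map f p : V -> V :=
  'd (xget (fun=> 0) (C1_extension f p)) (e p).

Definition C1_diffeo f g : Prop :=
  [/\ cancel f g, cancel g f, C1 f & C1 g].

Definition C1_close (eps : R) f g : Prop :=
  forall p, `|e (f p) - e (g p)| < eps /\
    forall v, tangent p v ->
      `|tangent_map f p v - tangent_map g p v| <= eps * `|v|.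

Definition top_conjugate f g : Prop :=
  exists h k : initial_topology e -> initial_topology e,
    [/\ cancel h k, cancel k h, continuous h, continuous k &
        forall p, h (f p) = g (h p)].

Definition C1_structurally_stable f : Prop :=
  (exists f', C1_diffeo f f') /\
  exists2 eps : R, 0 < eps &
    forall g g', C1_diffeo g g' -> C1_close eps f g -> top_conjugate f g.

Definition subspace (E : set V) : Prop :=
  E 0 /\ forall (a : R) u v, E u -> E v -> E (a *: u + v).

(* Continuity of the splitting follows from the other clauses. *)
Definition Anosov f : Prop :=
  exists f', C1_diffeo f f' /\
  exists (Es Eu : M -> set V) (C lambda : R),
    [/\ 0 < C, 0 < lambda < 1 &
     forall p,
      [/\ subspace (Es p) /\ subspace (Eu p),
          tangent p = [set u + v | u in Es p & v in Eu p] /\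
            Es p `&` Eu p = [set 0],
          tangent_map f p @` Es p = Es (f p) /\
            tangent_map f p @` Eu p = Eu (f p),
          forall v n, Es p v ->
            `|tangent_map (iter n f) p v| <= C * lambda ^+ n * `|v| &
          forall v n, Eu p v ->
            `|tangent_map (iter n f') p v| <= C * lambda ^+ n * `|v| ]].

(* p is a periodic point, f^n(p) = p, and no eigenvalue of the tangent map of *)
(* f^n at p, acting on the complexified tangent space, has modulus 1: below,  *)
(* u + i v is an eigenvector with eigenvalue a + i b.                         *)
Definition hyperbolic_periodic f n p : Prop :=
  forall (a b : R) (u v : V), a ^+ 2 + b ^+ 2 = 1 ->
    tangent p u -> tangent p v ->
    tangent_map (iter n f) p u = a *: u - b *: v ->
    tangent_map (iter n f) p v = b *: u + a *: v ->
    u = 0 /\ v = 0.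

(* The consequence of Mane's theorem for the manifold M. *)
Definition mane_theorem : Prop :=
  forall f, C1_structurally_stable f ->
    forall n p, (0 < n)%N -> iter n f p = p -> hyperbolic_periodic f n p.

End EmbeddedManifold.

(* Main.v *)
(* Every automorphism Phi acts on pairs (g^a, g^b), where g^4 = 1, through the
   matrix A mod 4 acting on (a, b), and A mod 4 has finite order n.  So all
   points (g, 1) with g a unit imaginary quaternion, which form a 2-sphere, are
   fixed by the n-th iterate of F_Phi, and the derivative of this iterate fixes
   the velocity of every curve in the sphere.  Such periodic points are not
   hyperbolic.  In an Anosov splitting, both components of such a velocity
   would be fixed as well, and the exponential estimates force them to vanish. *)

Require Import Defs.
From mathcomp Require Import all_boot all_order all_algebra spectral.
From mathcomp Require Import all_classical all_reals all_analysis complex.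
From mathcomp Require Import ring lra.
Set Implicit Arguments.
Unset Strict Implicit.
Unset Printing Implicit Defensive.
Import Order.TTheory GRing.Theory Num.Theory.
Import numFieldNormedType.Exports.
Local Open Scope ring_scope.
Local Open Scope classical_set_scope.

(** * Finite-dimensional coordinates and composition of [C^1] maps *)

Section Coordinates.
Variable R : realType.

(** Finite dimensionality in the form that the composition of [C^1] maps uses: a finite spanning
    family with continuous coefficients. *)
Definition has_coordinates (V : normedModType R) : Prop :=
  exists (I : finType) (b : I -> V) (c : I -> V -> R),
    (forall i, continuous (c i)) /\ forall v, v = \sum_i c i v *: b i.

Lemma has_coordinates_mx m n : has_coordinates 'M[R]_(m.+1, n.+1).
Proof.
exists ('I_m.+1 * 'I_n.+1)%type, (fun ij => delta_mx ij.1 ij.2), (fun ij (M : 'M[R]_(m.+1, n.+1)) => M ij.1 ij.2).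
split=> [ij|M]; first exact: coord_continuous.
by rewrite [LHS]matrix_sum_delta pair_bigA.
Qed.

Lemma has_coordinates_prod (V W : normedModType R) :
  has_coordinates V -> has_coordinates W ->
  has_coordinates (V * W)%type.
Proof.
move=> [I [b [c [cc bc]]]] [J [b' [c' [cc' bc']]]].
exists (I + J)%type,
  (fun k => match k with inl i => (b i, 0) | inr j => (0, b' j) end),
  (fun k vw => match k with inl i => c i vw.1 | inr j => c' j vw.2 end).
split=> [[i|j] vw|[v w]].
- by apply: continuous_comp; [exact: cvg_fst | exact: cc].
- by apply: continuous_comp; [exact: cvg_snd | exact: cc'].
rewrite big_sumType /= {1}(bc v) {1}(bc' w).
apply: injective_projections => /=.
- rewrite !(big_morph fst (id1 := 0) (op1 := +%R))//= [X in _ + X]big1 ?addr0//.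
  by move=> j _; rewrite scaler0.
- rewrite !(big_morph snd (id1 := 0) (op1 := +%R))//= [X in X + _]big1 ?add0r//.
  by move=> j _; rewrite scaler0.
Qed.

Variables (V : normedModType R) (coordV : has_coordinates V).

Lemma coordE_linear (I : finType) (b : I -> V) (c : I -> V -> R)
    (L : {linear V -> V}) :
  (forall v, v = \sum_i c i v *: b i) ->
  forall v, L v = \sum_i c i v *: L (b i).
Proof.
move=> bc v; rewrite {1}(bc v) linear_sum.
by apply: eq_bigr => i _; rewrite linearZ.
Qed.

(** [C1_near] makes ['d G z v] continuous in [z] only for fixed [v], whereas the chain rule applies
    ['d G (F z)] to the moving vector ['d F z v]. Expanding this vector in coordinates leaves a
    finite sum of continuous scalars times values of ['d G (F z)] at the fixed vectors [b i]. *)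
Lemma C1_near_comp (F G : V -> V) x :
  C1_near F x -> C1_near G (F x) -> C1_near (G \o F) x.
Proof.
move=> nF nG.
have cF : {for x, continuous F}.
  by apply: differentiable_continuous; have [] := nbhs_singleton nF.
have dFG : \forall y \near x,
    (differentiable F y /\ forall v, {for y, continuous (fun z => 'd F z v)}) /\
    (differentiable G (F y) /\
       forall v, {for F y, continuous (fun z => 'd G z v)}).
  exact: filterI nF (cF _ nG).
(* Continuity at [y] needs the chain rule at all points near [y]; passing to the interior supplies
   such a neighbourhood. *)
have := nbhs_interior dFG; apply: filterS => y /= nyP.
have [[dF contF] [dG contG]] := nbhs_singleton nyP.
split=> [|v]; first exact: differentiable_comp.
have [I [b [c [cc bc]]]] := coordV.
have E : \forall z \near y,
    \sum_i c i ('d F z v) *: 'd G (F z) (b i) = 'd (G \o F) z v.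
  apply: filterS nyP => z [[dFz _] [dGz _]].
  have -> : 'd (G \o F) z v = 'd G (F z) ('d F z v) :=
    congr1 (fun L : V -> V => L v) (diff_comp dFz dGz).
  by rewrite [RHS](coordE_linear _ bc).
rewrite /continuous_at /prop_for -(nbhs_singleton E).
apply: cvg_trans.
  apply: near_eq_cvg; exact: E.
apply: cvg_big => [|i _]; first exact: add_continuous.
apply: cvgZ.
  by apply: continuous_comp; [exact: contF|exact: cc].
apply: (@continuous_comp _ _ _ F (fun z => 'd G z (b i))).
  exact: differentiable_continuous.
exact: contG.
Qed.

End Coordinates.

(** * Tangent maps along curves, and curves of periodic points *)

Section TangentMap.
Variables (R : realType) (M : choiceType) (V : normedModType R) (e : M -> V).
Implicit Types (f g : M -> M) (p : M) (v : V).

Definition velocity (gamma : R -> M) v := is_derive (0 : R) (1 : R) (e \o gamma) v.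

Lemma velocity_unique (gamma : R -> M) v w :
  velocity gamma v -> velocity gamma w -> v = w.
Proof. by move=> [_ <-] [_ <-]. Qed.

(** Chain rule for the extension [F] chosen by [tangent_map]: [e \o gamma] is continuous at [0], so
    for small times the curve stays where [F] agrees with [f]. *)
Lemma velocity_tangent_map f p (gamma : R -> M) v :
  C1 e f -> gamma 0 = p -> velocity gamma v ->
  velocity (f \o gamma) (tangent_map e f p v).
Proof.
move=> C1f g0 [dg gv]; rewrite /tangent_map.
(* [C1 e f] provides an extension, so [xget] returns a genuine one and not its default. *)
have [F0 F0ext] := C1f p; have [] := xgetPex (fun=> 0) (ex_intro _ F0 F0ext).
set F := xget _ _ => nF ext.
have [dF _] := nbhs_singleton nF.
have dg1 : differentiable (e \o gamma) (0 : R) by apply/derivable1_diffP.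
have FE : \forall t \near (0 : R), F (e (gamma t)) = e (f (gamma t)).
  have cg : {for (0 : R), continuous (e \o gamma)} by exact: differentiable_continuous.
  have ext' : \forall x \near (e \o gamma) 0, forall q, e q = x -> F x = e (f q).
    by rewrite /= g0.
  have : \forall t \near (0 : R), forall q, e q = e (gamma t) ->
      F (e (gamma t)) = e (f q) by exact: cg _ ext'.
  by apply: filterS => t; exact.
apply: (@near_eq_is_derive _ _ _ (F \o (e \o gamma))).
- exact: FE.
have dFg : differentiable F ((e \o gamma) 0) by rewrite /= g0.
have dd : differentiable (F \o (e \o gamma)) 0 by exact: differentiable_comp.
apply: DeriveDef; first exact: diff_derivable.
rewrite deriveE// diff_comp//= g0; congr ('d F _ _).
by rewrite -gv deriveE.
Qed.

(** By uniqueness of derivatives, any one curve determines the tangent map on its velocity,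
    whichever extension was chosen. *)
Lemma tangent_mapE f p (gamma : R -> M) v w :
  C1 e f -> gamma 0 = p -> velocity gamma v -> velocity (f \o gamma) w ->
  tangent_map e f p v = w.
Proof.
by move=> C1f g0 gv; apply: velocity_unique; exact: velocity_tangent_map.
Qed.

Lemma tangent0 p : tangent e p 0.
Proof. by exists (fun=> p); split=> //; exact: is_derive_cst. Qed.

Hypothesis coordV : has_coordinates V.

Lemma C1_comp f g : C1 e f -> C1 e g -> C1 e (f \o g).
Proof.
move=> C1f C1g p; have [G [nG extG]] := C1g p.
have [F [nF extF]] := C1f (g p).
have Gp : G (e p) = e (g p) by exact: (nbhs_singleton extG).
have cG : {for e p, continuous G}.
  by apply: differentiable_continuous; have [] := nbhs_singleton nG.
exists (F \o G); split; first by apply: C1_near_comp; rewrite ?Gp.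
have extF' : \forall x \near e p, forall q, e q = G x -> F (G x) = e (f q).
  by apply: (cG (fun y => forall q, e q = y -> F y = e (f q))); rewrite /= Gp.
near=> x => q eq /=.
have Gx : G x = e (g q) by apply: (near extG x).
by apply: (near extF' x).
Unshelve. all: by end_near.
Qed.

Lemma C1_id : C1 e id.
Proof.
move=> p; exists id; split; last by apply: filterE => x q ->.
rewrite /C1_near; apply: filterE => y; split=> // v.
have -> : (fun z : V => 'd id z v) = fun=> v.
  by apply/funext => z; rewrite diff_val.
exact: cst_continuous.
Qed.

Lemma C1_iter f n : C1 e f -> C1 e (iter n f).
Proof.
by move=> C1f; elim: n => [|n IHn]; [exact: C1_id | exact: C1_comp].
Qed.

(** The extensions chosen for [f], [g] and [f \o g] are unrelated; the three tangent maps are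
    compared along a curve with velocity [v], hence the restriction to tangent vectors. *)
Lemma tangent_map_comp f g p v : C1 e f -> C1 e g -> tangent e p v ->
  tangent_map e (f \o g) p v = tangent_map e f (g p) (tangent_map e g p v).
Proof.
move=> C1f C1g [gamma [g0 gv]].
apply: (@tangent_mapE _ _ gamma) => //; first exact: C1_comp.
apply: (@velocity_tangent_map f _ (g \o gamma)) => //=; first by rewrite g0.
exact: velocity_tangent_map.
Qed.

(** The iterate fixes the curve pointwise, hence also its velocity. *)
Lemma periodic_curve_tangent_map f n p (gamma : R -> M) v :
  C1 e f -> gamma 0 = p -> velocity gamma v ->
  (forall t, iter n f (gamma t) = gamma t) ->
  tangent_map e (iter n f) p v = v.
Proof.
move=> C1f g0 gv per; apply: (@tangent_mapE _ _ gamma) => //.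
  exact: C1_iter.
by have -> : iter n f \o gamma = gamma by exact/funext.
Qed.

Lemma periodic_curve_not_hyperbolic f n p (gamma : R -> M) v :
  C1 e f -> gamma 0 = p -> velocity gamma v -> v != 0 ->
  (forall t, iter n f (gamma t) = gamma t) ->
  ~ hyperbolic_periodic e f n p.
Proof.
move=> C1f g0 gv v0 per.
(* The eigenvalue is [1 + 0 i], with the real eigenvector [v]. *)
move=> /(_ 1 0 v 0); rewrite expr1n expr0n addr0 => /(_ erefl).
rewrite (periodic_curve_tangent_map C1f g0 gv per).
have -> : tangent_map e (iter n f) p 0 = 0 by rewrite /tangent_map linear0.
rewrite !scale1r !scale0r subr0 addr0.
case=> //; first by exists gamma.
  exact: tangent0.
by move=> v_eq0; rewrite v_eq0 eqxx in v0.
Qed.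

(** The bound tends to [0] as [k] grows, since [lambda ^+ n < 1]. The exponents are multiples of a
    period [n], the times at which a vector will be known to be fixed. *)
Lemma contraction_fixed_eq0 (C lambda : R) n v : 0 < C -> 0 < lambda < 1 ->
  (0 < n)%N -> (forall k, `|v| <= C * lambda ^+ (k * n) * `|v|) -> v = 0.
Proof.
move=> C0 /andP[l0 l1] n0 H; apply/eqP; rewrite -normr_le0.
have : (fun k => C * (lambda ^+ n) ^+ k * `|v|) @ \oo --> (C * 0 * `|v| : R).
  apply: cvgM; last exact: cvg_cst.
  apply: cvgM; first exact: cvg_cst.
  apply: cvg_expr; rewrite ger0_norm ?exprn_ge0 ?ltW//.
  by rewrite exprn_ilt1 ?ltW// -lt0n.
rewrite mulr0 mul0r => cv.
have := cvg_lim (@Rhausdorff R) cv => <-.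
apply: limr_ge; first by apply/cvg_ex; eexists; exact: cv.
by apply: nearW => k; rewrite -exprM mulnC.
Qed.

Lemma tangent_map_iter_invariant f (E : M -> set V) :
  C1 e f -> (forall p v, E p v -> tangent e p v) ->
  (forall p v, E p v -> E (f p) (tangent_map e f p v)) ->
  forall m p v, E p v -> E (iter m f p) (tangent_map e (iter m f) p v).
Proof.
move=> C1f Etan Ef; elim=> [|m IHm] p v Ev /=.
  have [gamma [g0 gv]] := Etan _ _ Ev.
  by rewrite (tangent_mapE C1_id g0 gv gv).
rewrite (@tangent_map_comp f (iter m f))//; first exact/Ef/IHm.
  exact: C1_iter.
exact: Etan.
Qed.

Lemma tangent_map_iter_fixed f k p v : C1 e f -> tangent e p v -> f p = p ->
  tangent_map e f p v = v -> tangent_map e (iter k f) p v = v.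
Proof.
move=> C1f tv fp fv; elim: k => [|k IHk] /=.
  by have [gamma [g0 gv]] := tv; rewrite (tangent_mapE C1_id g0 gv gv).
rewrite (@tangent_map_comp f (iter k f))//; last exact: C1_iter.
by rewrite IHk iter_fix.
Qed.

(** The curve [f \o gamma] has velocity [tangent_map e f p v], and [f'] carries it back to
    [gamma]. *)
Lemma tangent_map_cancel f f' p v : C1 e f -> C1 e f' -> cancel f f' ->
  tangent e p v ->
  tangent_map e f' (f p) (tangent_map e f p v) = v.
Proof.
move=> C1f C1f' ff' [gamma [g0 gv]].
apply: (@tangent_mapE _ _ (f \o gamma)) => //=; first by rewrite g0.
  exact: velocity_tangent_map.
by have -> : f' \o (f \o gamma) = gamma by apply/funext => t /=; rewrite ff'.
Qed.

Lemma Anosov_no_periodic_curve f n p (gamma : R -> M) v :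
  Anosov e f -> (0 < n)%N -> gamma 0 = p -> velocity gamma v ->
  (forall t, iter n f (gamma t) = gamma t) -> v = 0.
Proof.
move=> [f' [[ff' f'f C1f C1f'] [Es [Eu [C [lambda [C0 lam split_]]]]]]] n0 g0 gv per.
have pn : iter n f p = p by rewrite -g0 per.
have Es_tan q w : Es q w -> tangent e q w.
  move=> qw; have [[_ [Eu0 _]] [-> _] _ _ _] := split_ q.
  by exists w => //; exists 0 => //; rewrite addr0.
have Eu_tan q w : Eu q w -> tangent e q w.
  move=> qw; have [[[Es0 _] _] [-> _] _ _ _] := split_ q.
  by exists 0 => //; exists w => //; rewrite add0r.
have Es_f q w : Es q w -> Es (f q) (tangent_map e f q w).
  by move=> qw; have [_ _ [<- _] _ _] := split_ q; exists w.
have Eu_f q w : Eu q w -> Eu (f q) (tangent_map e f q w).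
  by move=> qw; have [_ _ [_ <-] _ _] := split_ q; exists w.
have [[[Es0 EsD] [Eu0 EuD]] [tE EsEu] _ cs cu] := split_ p.
have : tangent e p v by exists gamma.
rewrite tE => -[s Ess [u Euu suv]].
have Tv := periodic_curve_tangent_map C1f g0 gv per.
set T := tangent_map e (iter n f) p in Tv.
have TsE : Es p (T s).
  by rewrite -{1}pn; exact: tangent_map_iter_invariant.
have TuE : Eu p (T u).
  by rewrite -{1}pn; exact: tangent_map_iter_invariant.
(* This follows from [T v = v] by linearity. The left side lies in [Es p] and the right side in
   [Eu p], which meet only in [0], so [T] fixes both [s] and [u]. *)
have TsTu : T s - s = u - T u.
  apply/eqP; rewrite subr_eq addrAC eq_sym subr_eq [u + s]addrC suv -Tv -suv.
  by rewrite /T /tangent_map linearD.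
have Ts0 : T s - s = 0.
  have : (Es p `&` Eu p) (T s - s).
    split; first by rewrite addrC -scaleN1r; exact: EsD.
    by rewrite TsTu addrC -scaleN1r; exact: EuD.
  by rewrite EsEu.
have Ts : T s = s by apply/eqP; rewrite -subr_eq0 Ts0.
have Tu : T u = u by apply/esym/eqP; rewrite -subr_eq0 -TsTu Ts0.
have iterMf g k : iter (k * n) g = iter k (iter n g) :> (M -> M).
  by apply/funext => q; rewrite iterM.
have s0 : s = 0.
  apply: (contraction_fixed_eq0 C0 lam n0) => k.
  rewrite -{1}(@tangent_map_iter_fixed (iter n f) k p s) -?iterMf//; first exact: cs.
    exact: C1_iter.
  exact: Es_tan.
(* The unstable estimate concerns the inverse [f']. Since [iter (k * n) f] fixes [p] and its tangent
   map fixes [u], the tangent map of [iter (k * n) f'] fixes [u] too. *)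
have u0 : u = 0.
  apply: (contraction_fixed_eq0 C0 lam n0) => k.
  have pk : iter (k * n) f p = p by rewrite iterMf iter_fix.
  have uk : tangent_map e (iter (k * n) f) p u = u.
    rewrite iterMf; apply: tangent_map_iter_fixed => //; first exact: C1_iter.
    exact: Eu_tan.
  have cancel_iter m : cancel (iter m f) (iter m f').
    by move=> q; elim: m => //= m IHm; rewrite -iterS iterSr ff' IHm.
  have := @tangent_map_cancel (iter (k * n) f) (iter (k * n) f') p u
    (C1_iter _ C1f) (C1_iter _ C1f') (cancel_iter _) (Eu_tan _ _ Euu).
  by rewrite uk pk => {1}<-; exact: cu.
by rewrite -suv s0 u0 addr0.
Qed.

End TangentMap.

(** * Words in powers of an element with [g ^+ 4 = 1], and a common period *)

Section RootsOfUnity.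
Variables (G : groupType) (g : G) (g4 : (g ^+ 4 = 1)%g).
Implicit Types a b : 'Z_4.

Lemma expg_mod4 k : (g ^+ (k %% 4) = g ^+ k)%g.
Proof. by rewrite [in RHS](divn_eq k 4) expgnDr mulnC expgnA g4 expg1n mul1g. Qed.

Lemma expg_Z4D a b : (g ^+ (a + b)%R = g ^+ a * g ^+ b)%g.
Proof. by rewrite -expgnDr -[RHS]expg_mod4. Qed.

Lemma expg_Z4N a : (g ^+ (- a)%R = (g ^+ a)^-1)%g.
Proof. by apply: (mulgI (g ^+ a)%g); rewrite -expg_Z4D subrr mulgV. Qed.

(** Powers of [g] commute, so only the exponent sums of the word matter. *)
Lemma word_eval_expg_Z4 (x : 'cV['Z_4]_2) (w : F2) :
  (word_eval (fun i => g ^+ (x i ord0)) w =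
   g ^+ (\sum_j (exponent_sum j w)%:~R * x j ord0)%R)%g.
Proof.
case: w => w rw; rewrite /word_eval /exponent_sum /= => {rw}.
elim: w => [|[i s] w IHw].
  by rewrite big_nil big1// => j _; rewrite big_nil mul0r.
rewrite big_cons {}IHw.
(* The exponent contributed by the first letter, written as a sum over [j] so that it merges
   termwise with the exponent of the tail. *)
pose u : 'Z_4 := \sum_j ((if i == j then if s then -1 else 1 else 0) : int)%:~R * x j ord0.
have uE : u = (if s then - x i ord0 else x i ord0).
  rewrite {}/u (bigD1 i)//= eqxx big1 => [|j /negbTE ji].
    by rewrite [LHS]addr0; case: s; rewrite ?mulrN1z ?mulr1z ?mulN1r ?mul1r.
  by rewrite eq_sym ji mul0r.
have -> : (if (i, s).2 then (g ^+ x (i, s).1 ord0)^-1 else g ^+ x (i, s).1 ord0)%g = (g ^+ u)%g.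
  by rewrite uE /=; case: (s) => //; rewrite expg_Z4N.
rewrite -expg_Z4D {uE}/u -big_split; congr (g ^+ _)%g; congr nat_of_ord.
apply: eq_bigr => j _; rewrite big_cons /=.
by case: eqP => _; rewrite ?mul0r ?add0r// rmorphD mulrDl.
Qed.
End RootsOfUnity.

(** Determinant [1] makes the matrix invertible modulo 4, hence a permutation of the finite set of
    exponent vectors. The period is the length of the orbit of [(1, 0)] there, so it is the same for
    every [g]. *)
Lemma F_iter_period (R : realType) (Phi : F2 -> F2) :
  \det (row_exponent Phi) = 1 ->
  exists2 n, (0 < n)%N & forall g : SU2 R, (g ^+ 4 = 1)%g ->
    iter n (@F_ R Phi) (g, 1%g) = (g, 1%g).
Proof.
move=> detA.
pose B : 'M['Z_4]_2 := map_mx intr (row_exponent Phi).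
have uB : B \in unitmx by rewrite unitmxE det_map_mx detA rmorph1 unitr1.
pose x0 : 'cV['Z_4]_2 := delta_mx 0 0.
pose mulB (x : 'cV['Z_4]_2) := B *m x.
exists (order mulB x0) => [|g g4]; first exact: order_gt0.
pose P (x : 'cV['Z_4]_2) := ((g ^+ x 0%R ord0)%g, (g ^+ x 1%R ord0)%g).
have FP x : F_ Phi (P x) = P (mulB x).
  rewrite /F_ /P /=.
  have -> : (fun i : 'I_2 => if i == 0 then (g ^+ x 0%R ord0)%g else (g ^+ x 1%R ord0)%g) =
            (fun i => (g ^+ x i ord0)%g).
    by apply/funext => -[[|[|//]] lti]; congr (g ^+ x _ ord0)%g; exact: val_inj.
  rewrite !word_eval_expg_Z4//.
  by congr pair; congr (g ^+ _)%g; congr nat_of_ord; rewrite mxE;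
    apply: eq_bigr => j _; rewrite !mxE.
have Pn n : iter n (@F_ R Phi) (P x0) = P (iter n mulB x0).
  by elim: n => //= n ->; exact: FP.
have <- : P x0 = (g, 1%g) by rewrite /P !mxE.
rewrite Pn iter_order//; exact: can_inj (mulKmx uB).
Qed.

(** * A circle of unit imaginary quaternions and its velocity *)

Section Curve.
Variable R : realType.
Local Open Scope complex_scope.

(* The imaginary unit quaternion cos t i + sin t j *)
Definition quat_mx (t : R) : 'M[R[i]]_2 :=
  \matrix_(i, j) if i == j then 0 +i* (if i == 0 then cos t else - cos t)
                 else (if i == 0 then sin t else - sin t) +i* 0.

Lemma quat_mx_sqr t : quat_mx t *m quat_mx t = - 1%:M.
Proof.
have cs := cos2Dsin2 t.
apply/matrixP => -[[|[|//]] lti] -[[|[|//]] ltj]; rewrite !mxE !big_ord_recl big_ord0 !mxE /=; simpc;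
 apply/eqP; rewrite eq_complex /=; apply/andP; split; apply/eqP; rewrite ?mulr1n ?mulr0n/=. 
all: by nra.
Qed.

(** The adjoint of an imaginary quaternion is its negative, so unitarity reduces to the square being
    [-1]. *)
Lemma quat_mx_SU2 t : (quat_mx t \is unitarymx) && (\det (quat_mx t) == 1).
Proof.
have cs := cos2Dsin2 t.
apply/andP; split.
  apply/unitarymxP.
  have -> : ((quat_mx t)^t* = - quat_mx t)%sesqui.
    by apply/matrixP => -[[|[|//]] lti] -[[|[|//]] ltj]; rewrite !mxE /=;
      apply/eqP; rewrite eq_complex /= ?oppr0 ?opprK !eqxx.
  by rewrite mulmxN quat_mx_sqr opprK.
rewrite (expand_det_row _ 0) !big_ord_recl big_ord0 /cofactor !det_mx11 !mxE /=.
by simpc; rewrite eq_complex /= -!expr2 cs !eqxx.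
Qed.

Definition quat t : SU2 R := MkSU2 (quat_mx_SU2 t).

Lemma quat4 t : (quat t ^+ 4 = 1)%g.
Proof.
rewrite (expgnA _ 2 2) !expg2; apply/val_inj; rewrite /= quat_mx_sqr.
by rewrite mulNmx mulmxN mul1mx opprK.
Qed.

(** The quaternion [j] in the first factor, split into real and imaginary parts, and [0] in the
    second: the derivative of [cos t i + sin t j] at [t = 0]. *)
Definition quat_velocity : 'M[R]_2 * 'M[R]_2 * ('M[R]_2 * 'M[R]_2) :=
  (delta_mx 0 1 - delta_mx 1 0, 0, (0, 0)).

Lemma quat_velocity_neq0 : quat_velocity != 0.
Proof.
apply/eqP => -[] /matrixP /(_ 0 1); rewrite !mxE /= subr0 => /eqP.
by rewrite oner_eq0.
Qed.

Lemma is_derive_scalel (W : normedModType R) (k : R -> R) (w : W) (t dk : R) :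
  is_derive t (1 : R) k dk -> is_derive t (1 : R) (fun s => k s *: w) (dk *: w).
Proof.
move=> [/derivable1_diffP dfk <-].
apply: DeriveDef; first exact/diff_derivable/differentiableZl.
by rewrite deriveE ?diffZl ?deriveE//; exact: differentiableZl.
Qed.

Lemma is_derive_quat :
  is_derive (0 : R) 1 (fun t => emb (quat t, 1%g)) quat_velocity.
Proof.
(* The quaternion [i] in the first factor. *)
pose w : 'M[R]_2 * 'M[R]_2 * ('M[R]_2 * 'M[R]_2) :=
  (0, delta_mx 0 0 - delta_mx 1 1, (0, 0)).
have -> : (fun t => emb (quat t, 1%g)) =
    (fun t => sin t *: quat_velocity) + (fun t => cos t *: w) +
    cst (0, 0, reim (1%g : SU2 R)).
  apply/funext => t; rewrite !fctE /emb /quat_velocity /w /=.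
  congr (_, _, _).
  - by apply/matrixP => -[[|[|//]] lti] -[[|[|//]] ltj]; rewrite !mxE /=; ring.
  - by apply/matrixP => -[[|[|//]] lti] -[[|[|//]] ltj]; rewrite !mxE /=; ring.
  change (reim (1%g : SU2 R) =
          sin t *: 0 + cos t *: 0 + reim (1%g : SU2 R)).
  by rewrite !scaler0 !add0r.
(* The left side is the derivative in the shape that the sum rule produces, with one term each for
   [sin], [cos] and the constant. *)
have E : cos 0 *: quat_velocity + - sin 0 *: w + 0 = quat_velocity.
  by rewrite cos0 sin0 oppr0 scale0r scale1r !addr0.
rewrite -[X in is_derive _ _ _ X]E; apply: is_deriveD.
by apply: is_deriveD; exact: is_derive_scalel.
Qed.

End Curve.

Theorem theorem9p2 (R : realType) (A : 'M[int]_2)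
  (detA : \det A = 1) (hypA : hyperbolic_mx A)
  (Phi : {multiplicative F2 -> F2}) (autPhi : bijective Phi)
  (liftA : row_exponent Phi = A) :
  ~ Anosov (@emb R) (@F_ R Phi) /\
  (mane_theorem (@emb R) -> ~ C1_structurally_stable (@emb R) (@F_ R Phi)).
Proof.
have detR : \det (row_exponent Phi) = 1 by rewrite liftA.
have [n n0 per] := F_iter_period R detR.
pose gamma (t : R) : SU2 R * SU2 R := (quat t, 1%g).
have perg t : iter n (F_ Phi) (gamma t) = gamma t by apply: per; exact: quat4.
have velg : velocity (@emb R) gamma (quat_velocity R) := is_derive_quat R.
have coordV : has_coordinates ('M[R]_2 * 'M[R]_2 * ('M[R]_2 * 'M[R]_2))%type.
  by do !apply: has_coordinates_prod; exact: has_coordinates_mx.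
have v0 := quat_velocity_neq0 R.
split=> [anosov|mane stable].
  have := Anosov_no_periodic_curve coordV anosov n0 erefl velg perg.
  by move/eqP; rewrite (negbTE v0).
(* As in the Anosov case, the [C^1] regularity of the map is part of the assumption being
   refuted. *)
have [[f' [_ _ C1F _]] _] := stable.
apply: (periodic_curve_not_hyperbolic coordV C1F erefl velg v0 perg).
exact: mane.
Qed.
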